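(* Let $\mathcal{S}$ be the set of integer squares. (1) For any fixed square $a_0$ there are infinitely many Hilbert cubes $H(a_0;a_1,a_2)$ of dimension $d=2$ with this $a_0$ that are contained in $\mathcal{S}$. (2) For fixed $a_1$ there are only finitely many Hilbert cubes $H(a_0;a_1,\ldots,a_d)$ of dimension $d\ge 2$ with this $a_1$ that are contained in $\mathcal{S}$. The bound is effective: (a) for each $a_i$ ($1\le i\le d$) the upper bound $a_i\le \frac14(a_1-1)^2-a_0$ holds; (b) for each $a_i$ ($1\le i\le d$) there are at most $\tau(a_1)$ many choices.
   Context: $\mathcal{S}=\{n^2 : n\in\mathbb{N}\}$, where $\mathbb{N}$ denotes the non-negative integers. For integers $a_0,a_1,\ldots,a_d$ with $a_1,\ldots,a_d$ positive, the Hilbert cube of dimension $d$ is $H(a_0;a_1,\ldots,a_d)=\{a_0+\sum_{i=1}^d \varepsilon_i a_i : \varepsilon_i\in\{0,1\}\}$. For a positive integer $n$, $\tau(n)$ denotes the number of positive divisors of $n$.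
   Formalization: In (2)(b) the count of at most τ(a_1) choices for a_i is stated with a_0 fixed as well as a_1; with a_0 free it fails (a_1 = 225 has τ = 9 but allows at least 10 values of a_2). *)

(* Defs.v *)
(* Sets are those of MathComp-Analysis (set T := T -> Prop). *)
From HB Require Import structures.
From mathcomp Require Import all_boot all_order all_algebra.
From mathcomp Require Import boolp classical_sets functions cardinality.

Set Implicit Arguments.
Unset Strict Implicit.
Unset Printing Implicit Defensive.

Import Order.TTheory GRing.Theory Num.Theory.
Local Open Scope classical_set_scope.
Local Open Scope ring_scope.

Definition squares : set int := [set z | exists n : nat, z = n%:Z ^+ 2].

(* The sequence [a] lists a_1, ..., a_d, so that d = size a and the entry a_i of
   the usual 1-based numbering is a`_(i.-1); in particular a_1 = a`_0. *)
Definition hilbert_cube (a0 : int) (a : seq int) : set int :=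
  [set z | exists eps : 'I_(size a) -> bool,
     z = a0 + \sum_(i < size a) (eps i)%:R * a`_i].

Definition cube_in_squares (a0 : int) (a : seq int) : Prop :=
  (forall x, x \in a -> 0 < x) /\ hilbert_cube a0 a `<=` squares.

Definition tau (n : nat) : nat := size (divisors n).

(* Main.v *)
(* If b and b + a_1 are squares y^2 and x^2, then a_1 = (x - y)(x + y), so that
   b is determined by the divisor x - y of a_1 and 2 y + 1 <= a_1. This applies
   to b = a_0 + a_i, and to the sum b of a_0 and all a_i with i >= 2, which
   bounds the dimension of the cube as well. Part (1) comes from the solutions
   of u^2 + x^2 = v^2 + w^2 with x = v + 1. *)
Require Import Defs.
From HB Require Import structures.
From mathcomp Require Import all_boot all_order all_algebra.
From mathcomp Require Import boolp classical_sets functions cardinality.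
From mathcomp Require Import zify ring lra.

Set Implicit Arguments.
Unset Strict Implicit.
Unset Printing Implicit Defensive.

Import Order.TTheory GRing.Theory Num.Theory.
Local Open Scope classical_set_scope.
Local Open Scope ring_scope.

Lemma squares_ge0 (z : int) : squares z -> 0 <= z.
Proof. by case=> n ->; exact: sqr_ge0. Qed.

Lemma squares_gap_bound (b c : int) :
  0 < c -> squares b -> squares (b + c) -> 4 * b <= (c - 1) ^+ 2.
Proof.
move=> c0 [y ->] [x] e.
have xy : y%:Z + 1 <= x%:Z by rewrite expr2 [RHS]expr2 in e; nia.
have : 2 * y%:Z + 1 <= c by rewrite !expr2 in e; nia.
by rewrite !expr2; nia.
Qed.

(* With b = y^2 and b + n = x^2, the divisor d = x - y of n determines
   2 y = n / d - d. *)
Definition square_of_divisor (n d : nat) : int :=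
  (((n %/ d - d)./2)%N : int) ^+ 2.

Lemma squares_gap_divisor (b c : int) : 0 < c -> squares b -> squares (b + c) ->
  exists2 d, d \in divisors `|c|%N & b = square_of_divisor `|c| d.
Proof.
move=> c0 [y ->] [x] e.
have xy : (y < x)%N by rewrite !expr2 in e; nia.
have cE : `|c|%N = ((x + y) * (x - y))%N by rewrite !expr2 in e; nia.
exists (x - y)%N; first by rewrite -dvdn_divisors; [rewrite cE dvdn_mull | lia].
by rewrite /square_of_divisor cE mulnK ?subn_gt0//; congr (_%:Z ^+ 2); lia.
Qed.

Section Cube.
Variables (a0 : int) (a : seq int).

(** A predicate on [nat] rather than on ordinals lets the index sets used below be written directly,
    as [pred0], [pred1 i] or [i > 0]. *)
Lemma hilbert_cube_sum (P : pred nat) :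
  hilbert_cube a0 a (a0 + \sum_(i < size a | P i) a`_i).
Proof.
exists (fun i => P i); rewrite big_mkcond; congr (_ + _).
by apply: eq_bigr => i _; case: (P i); rewrite ?mul1r ?mul0r.
Qed.

Hypothesis cube : cube_in_squares a0 a.

Lemma cube_entry_gt0 (i : nat) : (i < size a)%N -> 0 < a`_i.
Proof. by move=> ilt; apply: cube.1; rewrite mem_nth. Qed.

Lemma cube_origin_squares : squares a0.
Proof.
by have := cube.2 _ (hilbert_cube_sum pred0); rewrite big_pred0// addr0.
Qed.

Lemma cube_sum_squares (P : pred nat) :
  squares (a0 + \sum_(i < size a | P i) a`_i).
Proof. exact: cube.2 (hilbert_cube_sum P). Qed.

(** Adjoining the index 0 to [P] gives another vertex of the cube. *)
Lemma cube_sum_squares_shift (P : pred nat) : (0 < size a)%N -> ~~ P 0%N ->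
  squares (a0 + \sum_(i < size a | P i) a`_i + a`_0).
Proof.
move=> s0 P0; have := cube_sum_squares (fun i => (i == 0%N) || P i).
rewrite (bigD1 (Ordinal s0))//= [in X in _ -> X]addrAC -addrA.
congr (squares (_ + (_ + _))); apply: eq_bigl => i.
rewrite -(inj_eq val_inj) /=.
by case: eqVneq => [->|]; rewrite ?(negPf P0) ?andbT ?andbF.
Qed.

Lemma cube_entry_squares (i : nat) : (i < size a)%N -> squares (a0 + a`_i).
Proof.
move=> ilt; have := cube_sum_squares (pred1 i).
by rewrite (big_pred1 (Ordinal ilt)).
Qed.

Lemma cube_entry_squares_shift (i : nat) : (0 < i < size a)%N ->
  squares (a0 + a`_i + a`_0).
Proof.
move=> /andP[i0 ilt]; have := @cube_sum_squares_shift (pred1 i).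
rewrite (big_pred1 (Ordinal ilt))//=; apply; first exact: leq_ltn_trans ilt.
by rewrite neq_ltn i0.
Qed.

Lemma cube_entry_bound (i : nat) : (1 < size a)%N -> (i < size a)%N ->
  4 * (a0 + a`_i) <= (a`_0 - 1) ^+ 2.
Proof.
move=> s1 ilt; have p0 := cube_entry_gt0 (ltnW s1).
case: i ilt => [_|i ilt]; last first.
  apply: squares_gap_bound => //; first exact: cube_entry_squares.
  exact: cube_entry_squares_shift.
(* For [i = 0] there is no shift by the entry itself, so a second direction is used: [a0 + c],
   [a0 + b] and [a0 + b + c] are the squares of v, w and x. *)
have p1 := cube_entry_gt0 s1.
have := cube_entry_squares_shift (i := 1) s1.
have := cube_entry_squares s1; have := cube_entry_squares (ltnW s1).
have := squares_ge0 cube_origin_squares.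
move: a`_0 a`_1 p0 p1 => c b c0 b0 a0_ge0 [v ev] [w ew] [x ex].
rewrite ev; rewrite !expr2 in ev ew ex *.
have [h|h] := leP c b; last first.
(* here w < v < x, so x - w >= 2 and c = (x - w)(x + w) >= 2 x *)
  have wv : w%:Z + 1 <= v%:Z by nia.
  have vx : v%:Z + 1 <= x%:Z by nia.
  have : 2 * (x%:Z + w%:Z) <= c by nia.
  nia.
(* Here v <= w < x, so c = x^2 - w^2 >= 2 w + 1 >= 2 v + 1. *)
have vw : v%:Z <= w%:Z by nia.
have wx : w%:Z + 1 <= x%:Z by nia.
have : 2 * w%:Z + 1 <= c by nia.
nia.
Qed.

(** The entries after the first are positive integers, so their sum is at least d - 1; a bound on
    that sum therefore bounds d. *)
Lemma cube_size_bound : (0 < size a)%N ->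
  4 * (size a).-1%:Z <= (a`_0 - 1) ^+ 2.
Proof.
move=> s0; pose P i := (0 < i)%N.
apply: le_trans (squares_gap_bound (cube_entry_gt0 s0)
  (cube_sum_squares P) (cube_sum_squares_shift s0 (P := P) isT)).
rewrite ler_pM2l// -[X in X <= _]add0r; apply: lerD.
  exact: squares_ge0 cube_origin_squares.
have -> : (size a).-1%:Z = \sum_(i < size a | P i) 1.
  rewrite /P; case: (size a) s0 => // n _.
  by rewrite big_mkcond big_ord_recl/= add0r sumr_const card_ord natz.
by apply: ler_sum => i _; rewrite -gtz0_ge1 cube_entry_gt0.
Qed.

End Cube.

(** Each pair is coded in a finite type by its first component, the length, and a table of [N]
    values whose part beyond the length is ignored. *)
Lemma finite_seq_bounded (N : nat) :
  finite_set [set p : int * seq int |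
    [/\ 0 <= p.1 < N%:Z, (size p.2 < N)%N
      & forall i, (i < size p.2)%N -> 0 <= p.2`_i < N%:Z]].
Proof.
case: N => [|N].
  by apply: sub_finite_set (finite_set0 _) => p [].
pose F (t : 'I_N.+1 * 'I_N.+1 * {ffun 'I_N.+1 -> 'I_N.+1}) : int * seq int :=
  ((t.1.1 : nat)%:Z, mkseq (fun i => (t.2 (inord i) : nat)%:Z) t.1.2).
apply: (@sub_finite_set _ _ (F @` setT)); last exact: finite_image.
move=> [b s] /= [b_bd s_bd a_bd].
exists (inord `|b|, inord (size s), [ffun i : 'I_N.+1 => inord `|s`_i|]) => //.
rewrite /F /= !inordK; try lia.
congr pair; first lia.
apply: (@eq_from_nth _ 0); rewrite size_mkseq// => i ilt.
have /andP[si0 siN] := a_bd i ilt.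
have iN : (i < N.+1)%N := ltn_trans ilt s_bd.
by rewrite nth_mkseq// ffunE (inordK iN) inordK -?ltz_nat gez0_abs.
Qed.

Lemma card_le_image_seq (T : eqType) (U : Type) (A : set U) (f : T -> U)
    (s : seq T) :
  (forall x, A x -> exists2 d, d \in s & x = f d) -> (A #<= `I_(size s))%card.
Proof.
move=> h; case: s h => [|d0 s] h.
  by rewrite (_ : A = set0) ?card_ge0// -subset0 => x /h[].
apply: (@card_le_trans _ _ _ ((fun i => f (nth d0 (d0 :: s) i)) @` `I_(size s).+1));
  last exact: card_image_le.
apply: subset_card_le => x /h[d ds ->]; exists (index d (d0 :: s)).
  by rewrite /= -index_mem in ds.
by rewrite nth_index.
Qed.

Section Family.
Variable u : nat.

(* With w = u + 2t + 1 and x = v + 1, v is chosen so that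
   x^2 - v^2 = 2v + 1 = (2t + 1)(2u + 2t + 1) = w^2 - u^2. *)
Definition family_v (t : nat) : nat := (u + 2 * t * (t + u + 1))%N.

Definition family_w (t : nat) : nat := (u + 2 * t + 1)%N.

Definition family_cube (t : nat) : set int :=
  hilbert_cube (u%:Z ^+ 2) [:: (family_v t)%:Z ^+ 2 - u%:Z ^+ 2;
                               (family_w t)%:Z ^+ 2 - u%:Z ^+ 2].

Lemma family_vertex t (z : int) : family_cube t z ->
  z \in [seq n%:Z ^+ 2 | n <- [:: u; family_v t; family_w t; (family_v t).+1]].
Proof.
case=> eps ->; rewrite !big_ord_recl big_ord0 /= !inE /family_v /family_w.
case: (eps _); case: (eps _); rewrite ?mul1r ?mul0r; apply/or4P.
- by apply: Or44; apply/eqP; lia.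
- by apply: Or42; apply/eqP; lia.
- by apply: Or43; apply/eqP; lia.
- by apply: Or41; apply/eqP; lia.
Qed.

Lemma family_top t : family_cube t ((family_v t).+1%:Z ^+ 2).
Proof.
exists (fun=> true); rewrite !big_ord_recl big_ord0 /= !mul1r /family_v /family_w; lia.
Qed.

(** At [t = 0] the first entry would vanish, since then v = u. *)
Lemma family_in_squares t : (0 < t)%N ->
  cube_in_squares (u%:Z ^+ 2) [:: (family_v t)%:Z ^+ 2 - u%:Z ^+ 2;
                               (family_w t)%:Z ^+ 2 - u%:Z ^+ 2].
Proof.
move=> t0; split=> [x|z /family_vertex/mapP[n _ ->]]; last by exists n.
rewrite !inE => /orP[]/eqP->; rewrite subr_gt0 ltrXn2r// ltz_nat /family_v /family_w.
  by nia.
by lia.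
Qed.

(** The vertex (v_s + 1)^2 lies in the cube for [t], whose largest vertex is (v_t + 1)^2, and v is
    strictly increasing in the parameter. *)
Lemma family_le s t : family_cube s = family_cube t -> (s <= t)%N.
Proof.
move=> e; have := family_top s; rewrite e => /family_vertex/mapP[n].
rewrite !inE => nE sE.
have {sE} : (family_v s).+1 = n by rewrite !expr2 in sE; nia.
move: nE; rewrite /family_v /family_w => /or4P[]/eqP-> ?; nia.
Qed.

Lemma family_inj : injective family_cube.
Proof. by move=> s t e; apply/eqP; rewrite eqn_leq !family_le. Qed.

End Family.

Theorem theorem1p4 :
  (forall a0 : int, squares a0 ->
     infinite_set [set H : set int | exists a1 a2 : int,
       cube_in_squares a0 [:: a1; a2] /\ H = hilbert_cube a0 [:: a1; a2]])
  /\
  (forall a1 : int, 0 < a1 ->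
     [/\ finite_set [set p : int * seq int |
           [/\ (2 <= size p.2)%N, p.2`_0 = a1 & cube_in_squares p.1 p.2]],
         forall (a0 : int) (a : seq int),
           (2 <= size a)%N -> a`_0 = a1 -> cube_in_squares a0 a ->
           forall i : nat, (i < size a)%N ->
             (a`_i)%:~R <= 1 / 4 * (a1%:~R - 1) ^+ 2 - a0%:~R :> rat
       & forall (a0 : int) (i : nat),
           ([set x : int | exists a : seq int,
              [/\ (2 <= size a)%N, a`_0 = a1, cube_in_squares a0 a,
                  (i < size a)%N & x = a`_i]]
             #<= `I_(tau `|a1|%N))%card]).
Proof.
split=> [_ [u ->] fin|a1 a1_gt0].
  apply: infinite_nat.
  (* If there were finitely many cubes, their preimage under an injective map would be finite, yet
     it is all of [nat]. The successor skips the degenerate [t = 0]. *)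
  apply: sub_finite_set (finite_preimage (f := family_cube u \o succn) _ fin).
    move=> t _; do 2 eexists; split; last by [].
    exact: (@family_in_squares u t.+1).
  by move=> s t _ _ /family_inj[].
split.
(* A single strict bound, a_1^2 + 1, serves for a_0, the dimension and all entries. *)
- pose N := (`|a1| * `|a1|).+1.
  have NE : N%:Z = a1 * a1 + 1 by rewrite /N; nia.
  apply: sub_finite_set (finite_seq_bounded N) => -[a0 a] /= [s a1E cube].
  have a0_ge0 := squares_ge0 (cube_origin_squares cube).
  have := cube_size_bound cube (ltnW s); rewrite a1E expr2 => size_bd.
  have := cube_entry_bound cube s (ltnW s); rewrite a1E expr2 => a0_bd.
  split=> [||i ilt]; first by rewrite NE/=; nia.
    by rewrite -ltz_nat NE/=; nia.
  have := cube_entry_bound cube s ilt; rewrite a1E expr2 NE.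
  have := cube_entry_gt0 cube ilt; rewrite /=; nia.
- move=> a0 a s a1E cube i ilt.
  have := cube_entry_bound cube s ilt; rewrite a1E.
  rewrite -(ler_int rat) !(rmorphM, rmorphD, rmorphXn, rmorphN)/=.
  lra.
- move=> a0 [|i].
    (* For [i = 0] the only value is [a1]; the divisor 1 accounts for it. *)
    apply: (@card_le_image_seq _ _ _ (fun=> a1)) => _ [a [_ a1E _ _ ->]].
    by exists 1%N; rewrite // -dvdn_divisors ?dvd1n ?absz_gt0 ?gt_eqF.
  apply: (@card_le_image_seq _ _ _ (fun d => square_of_divisor `|a1| d - a0)).
  move=> _ [a [s a1E cube ilt ->]].
  have [|||d dd e] := @squares_gap_divisor (a0 + a`_i.+1) a1 => //.
  + exact: cube_entry_squares.
  + by rewrite -a1E; exact: cube_entry_squares_shift.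
  + by exists d => //; rewrite -e addrC addKr.
Qed.
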